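(* Let $m$ be a nonnegative integer. Then $$(-1)^{m+1}\frac{\pi^{2m+2}}{4(2m+1)!}+\sum_{k=0}^m(-1)^k\frac{2^{2m-2k+1}\pi^{2k}}{(2k)!}\,\lambda(2m-2k+2)=0.$$
   Context: The Dirichlet lambda function is $\lambda(s)=\sum_{n=0}^\infty\frac{1}{(2n+1)^s}$ for $\mathrm{Re}(s)>1$. *)

(* Defs.v *)
From Stdlib Require Import Reals.
From Coquelicot Require Import Coquelicot.

Open Scope R_scope.

Definition Cexp (z : C) : C :=
  (exp (Re z) * cos (Im z), exp (Re z) * sin (Im z)).

(* [x ^ s] for a positive real base; a junk value when [x <= 0], where
   [ln x = 0]. *)
Definition RCpow (x : R) (s : C) : C := Cexp (s * RtoC (ln x))%C.

Definition lambda_term (s : C) (n : nat) : C :=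
  (1 / RCpow (2 * INR n + 1) s)%C.

(* Series in [C] are summed componentwise.  [Series] is total on [R]; the value
   is meaningful for [1 < Re s], where the series converges absolutely. *)
Definition dirichlet_lambda (s : C) : C :=
  (Series (fun n => Re (lambda_term s n)),
   Series (fun n => Im (lambda_term s n))).

(* Main.v *)
Require Import Defs.
From Stdlib Require Import Reals Factorial Lra Lia.
From Coquelicot Require Import Coquelicot.

(** Write [N = 2 n + 1] and [y = N PI / 2].  Up to the factor
    [2 ^ (2 m + 1) / N ^ (2 m + 2)], the contribution of the [n]-th terms of
    the lambda series to the sum over [k] is
    [sum_(k <= m) (-1)^k y^(2k) / (2k)!], the Taylor polynomial of [cos] of
    degree [2 m] at [y].  Since [N] is odd, [cos y = 0], so this
    polynomial is minus a Taylor remainder; in integral form, after rescaling the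
    variable, the contribution of [n] is [2 ^ (2 m + 1) (-1)^m] times
<<
      int_0^(PI/2) (PI/2 - u)^(2m+1) / (2m+1)! * cos (N u) du
>>
    ([taylor_moment_sum], proved by the recurrence that two integrations by
    parts give).

    It remains to sum these integrals over [n].  For every continuously
    differentiable [f],
<<
      sum_n int_0^(PI/2) f(u) cos ((2n+1) u) du = PI/4 * f(0)
>>
    ([cos_odd_series]).  This is Dirichlet's pointwise convergence theorem for
    the cosine system of odd frequencies.  For constant [f] it is the Leibniz
    series for [PI / 4].  For [f 0 = 0], the kernel identity
    [2 sin u * sum_(n <= M) cos ((2n+1) u) = sin (2 (M+1) u)] bounds the
    integrand near [0] uniformly in [M], and the Riemann-Lebesgue lemma deals
    with the rest of the interval.

    With [f u = (PI/2 - u)^(2m+1) / (2m+1)!], the value [PI/4 * f 0]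
    is, up to sign and the power of [2], the isolated term of the
    theorem.  The case [m = 0], where the integral is [1 / N^2], also shows that
    the series of the [1 / N^2] converges, and by comparison every lambda series
    involved does. *)

(** * Summing Fourier integrals with odd frequencies *)

(** Integrating by parts against [- cos (l u) / l] gains the factor [1 / l];
    the constant collects the boundary terms and a bound on [g']. *)
Lemma riemann_lebesgue_C1 (g g' : R -> R) (a b : R) :
  a <= b ->
  (forall x, a <= x <= b -> is_derive g x (g' x)) ->
  (forall x, a <= x <= b -> continuous g' x) ->
  exists K, forall l I, 0 < l ->
    is_RInt (fun u => g u * sin (l * u)) a b I -> Rabs I <= K / l.
Proof.
  intros Hab Hd Hc.
  destruct (bounded_continuity g' a b Hc) as [B HB].
  exists (Rabs (g a) + Rabs (g b) + (b - a) * B). intros l I Hl HI.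
  assert (Hparts : is_RInt
      (fun u => g u * sin (l * u) - g' u * cos (l * u) / l) a b
      (- g b * cos (l * b) / l - - g a * cos (l * a) / l)).
  { apply (is_RInt_derive (fun u => - g u * cos (l * u) / l));
      rewrite Rmin_left, Rmax_right by lra; intros x Hx.
    - auto_derive.
      + exists (g' x); now apply Hd.
      + replace (Derive (fun x => g x) x) with (g' x) by (symmetry; apply is_derive_unique; now apply Hd). field. lra.
    - apply (continuous_minus (fun u => g u * sin (l * u))
               (fun u => g' u * cos (l * u) / l)).
      + apply (ex_derive_continuous (fun u => g u * sin (l * u))).
        auto_derive. exists (g' x); now apply Hd.
      + apply (continuous_mult (fun u => g' u * cos (l * u)) (fun _ => / l)).
        * apply (continuous_mult g' (fun u => cos (l * u))); [now apply Hc|].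
          apply (ex_derive_continuous (fun u => cos (l * u))). now auto_derive.
        * apply continuous_const. }
  pose proof (is_RInt_minus _ _ _ _ _ _ HI Hparts) as Hrest.
  assert (Hr : Rabs (I - (- g b * cos (l * b) / l - - g a * cos (l * a) / l))
               <= (b - a) * (B / l)).
  { refine (norm_RInt_le_const _ _ _ _ (B / l) Hab _ Hrest).
    intros x Hx. unfold minus, plus, opp; simpl.
    replace (g x * sin (l * x) + - (g x * sin (l * x) - g' x * cos (l * x) / l))
      with (g' x * cos (l * x) * / l) by (field; lra).
    change (Rabs (g' x * cos (l * x) * / l) <= B * / l).
    rewrite !Rabs_mult, (Rabs_pos_eq (/ l)) by (left; now apply Rinv_0_lt_compat).
    apply Rmult_le_compat_r; [left; now apply Rinv_0_lt_compat|].
    specialize (HB x Hx). change (Rabs (g' x) < B) in HB.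
    assert (Rabs (cos (l * x)) <= 1) by (apply Rabs_le, COS_bound).
    pose proof (Rabs_pos (g' x)). pose proof (Rabs_pos (cos (l * x))). nra. }
  assert (He : forall x, Rabs (g x * cos (l * x)) <= Rabs (g x)).
  { intro x. rewrite Rabs_mult.
    assert (Rabs (cos (l * x)) <= 1) by (apply Rabs_le, COS_bound).
    pose proof (Rabs_pos (g x)). nra. }
  pose proof (He a) as Ha. pose proof (He b) as Hb.
  apply (Rmult_le_reg_r l); [easy|].
  rewrite <- (Rabs_pos_eq l) at 1 by lra. rewrite <- Rabs_mult.
  apply (Rmult_le_compat_r l) in Hr; [|lra].
  rewrite <- (Rabs_pos_eq l) in Hr at 5 by lra. rewrite <- Rabs_mult in Hr.
  replace ((I - (- g b * cos (l * b) / l - - g a * cos (l * a) / l)) * l)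
    with (I * l + g b * cos (l * b) - g a * cos (l * a)) in Hr by (field; lra).
  replace ((b - a) * (B / l) * l) with ((b - a) * B) in Hr by (field; lra).
  replace ((Rabs (g a) + Rabs (g b) + (b - a) * B) / l * l)
    with (Rabs (g a) + Rabs (g b) + (b - a) * B) by (field; lra).
  revert Hr Ha Hb. generalize (g b * cos (l * b)) (g a * cos (l * a)) ((b-a)*B).
  intros. apply Rabs_le. apply Rabs_le_between in Hr, Ha, Hb. lra.
Qed.

Lemma is_RInt_sum_n (f : nat -> R -> R) (a b : R) (I : nat -> R) (M : nat) :
  (forall n, is_RInt (f n) a b (I n)) ->
  is_RInt (fun u => sum_n (fun n => f n u) M) a b (sum_n I M).
Proof.
  intros H. induction M as [|M IH].
  - rewrite sum_O. apply (is_RInt_ext (f O)); [|easy].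
    intros x _. now rewrite sum_O.
  - rewrite sum_Sn.
    apply (is_RInt_ext (fun u => plus (sum_n (fun n => f n u) M) (f (S M) u))).
    + intros x _. now rewrite sum_Sn.
    + exact (is_RInt_plus (V := R_NormedModule) _ _ _ _ _ _ IH (H (S M))).
Qed.

(** Closed form of the Dirichlet kernel for odd frequencies: multiplying by
    [2 sin u] makes the sum telescope. *)
Lemma two_sin_mult_sum_cos_odd (u : R) (M : nat) :
  2 * sin u * sum_n (fun n => cos ((2 * INR n + 1) * u)) M
  = sin (2 * (INR M + 1) * u).
Proof.
  induction M as [|M IH].
  - rewrite sum_O; simpl.
    replace ((2 * 0 + 1) * u) with u by ring.
    replace (2 * (0 + 1) * u) with (2 * u) by ring.
    now rewrite sin_2a.
  - rewrite sum_Sn. change plus with Rplus.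
    rewrite Rmult_plus_distr_l, IH, S_INR.
    replace (2 * (INR M + 1) * u) with ((2 * (INR M + 1) + 1) * u - u) by ring.
    replace (2 * (INR M + 1 + 1) * u) with ((2 * (INR M + 1) + 1) * u + u) by ring.
    rewrite sin_minus, sin_plus. ring.
Qed.

(** Keeps the Dirichlet kernel of size [O(1 / u)] near [0], uniformly in the
    number of terms. *)
Lemma half_le_sin (u : R) : 0 <= u <= 1 -> u / 2 <= sin u.
Proof.
  intros Hu.
  pose proof (proj1 (pre_sin_bound u 0 ltac:(lra) ltac:(lra))) as H.
  unfold sin_approx, sin_term in H; simpl in H. nra.
Qed.

(** The partial sums are integrals of [f] against the Dirichlet kernel.  As
    [f u = O(u)] compensates the [1 / sin u] singularity, the integrand is
    bounded by a constant [K] on [[0, 1]] uniformly in [M], so a short interval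
    [[0, d]] contributes little; on [[d, PI / 2]] the function [f / (2 sin)]
    is continuously differentiable and the Riemann-Lebesgue lemma applies. *)
Lemma cos_odd_series_vanishing (f f' : R -> R) :
  (forall x, is_derive f x (f' x)) -> (forall x, continuous f' x) -> f 0 = 0 ->
  is_series (fun n => RInt (fun u => f u * cos ((2 * INR n + 1) * u)) 0 (PI / 2)) 0.
Proof.
  intros Hd Hc H0.
  pose proof PI2_1 as Hpi.
  set (D := fun M u => sum_n (fun n => cos ((2 * INR n + 1) * u)) M).
  assert (Hint : forall n, ex_RInt (fun u => f u * cos ((2 * INR n + 1) * u)) 0 (PI / 2)).
  { intro n. apply (ex_RInt_continuous (V := R_CompleteNormedModule)). intros x _.
    apply (ex_derive_continuous (fun u => f u * cos ((2 * INR n + 1) * u))).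
    auto_derive. now exists (f' x). }
  assert (Hsum : forall M, is_RInt (fun u => f u * D M u) 0 (PI / 2)
    (sum_n (fun n => RInt (fun u => f u * cos ((2 * INR n + 1) * u)) 0 (PI / 2)) M)).
  { intro M.
    apply (is_RInt_ext (fun u => sum_n (fun n => f u * cos ((2 * INR n + 1) * u)) M)).
    - intros x _. exact (sum_n_mult_l (K := R_Ring) (f x) _ M).
    - apply is_RInt_sum_n. intro n. now apply (RInt_correct (V := R_CompleteNormedModule)). }
  (* A Lipschitz constant of [f]; the symmetric interval is what the mean value
     bound at [0] asks for. *)
  assert (HK : exists K, 0 < K /\ forall u, 0 <= u <= 1 -> Rabs (f u) <= K * u).
  { destruct (bounded_continuity f' (-1) 1) as [K HK]; [intros x _; apply Hc|].
    exists K. split.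
    - apply Rle_lt_trans with (norm (f' 0)); [apply norm_ge_0|apply HK; lra].
    - intros u Hu.
      pose proof (bounded_variation f f' K 0 u) as Hv.
      rewrite H0, !Rminus_0_r, (Rabs_pos_eq u) in Hv by lra.
      apply Hv. intros t Ht. rewrite Rminus_0_r in Ht. apply Rabs_le_between in Ht.
      split; [apply Hd|]. left. apply HK. lra. }
  destruct HK as (K & HK0 & HK).
  assert (Hnear : forall M u, 0 <= u <= 1 -> Rabs (f u * D M u) <= K).
  { intros M u Hu. destruct (Req_dec u 0) as [->|Hu0].
    - rewrite H0, Rmult_0_l, Rabs_R0. lra.
    - pose proof (half_le_sin u Hu) as Hs.
      pose proof (two_sin_mult_sum_cos_odd u M) as Hk. fold (D M u) in Hk.
      assert (Hb : Rabs (2 * sin u * D M u) <= 1)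
        by (rewrite Hk; apply Rabs_le, SIN_bound).
      rewrite Rabs_mult, (Rabs_pos_eq (2 * sin u)) in Hb by lra.
      rewrite Rabs_mult. specialize (HK u Hu).
      pose proof (Rabs_pos (D M u)). pose proof (Rabs_pos (f u)).
      apply Rle_trans with (K * u * Rabs (D M u)).
      + now apply Rmult_le_compat_r.
      + assert (u * Rabs (D M u) <= 1).
        { apply Rle_trans with (2 := Hb). apply Rmult_le_compat_r; lra. }
        rewrite Rmult_assoc. nra. }
  match goal with |- is_series ?a _ => change (is_lim_seq (sum_n a) 0) end.
  apply is_lim_seq_spec. intros eps. destruct eps as [e He]. simpl.
  (* [d] makes the contribution [d * K] of [[0, d]] at most [e / 2]. *)
  set (d := Rmin 1 (e / (2 * K))).
  assert (Hd01 : 0 < d <= 1 /\ d * K <= e / 2).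
  { assert (0 < e / (2 * K)) by (apply Rdiv_lt_0_compat; lra).
    unfold d. split; [split; [apply Rmin_glb_lt; lra|apply Rmin_l]|].
    apply Rle_trans with (e / (2 * K) * K); [|right; field; lra].
    apply Rmult_le_compat_r; [lra|apply Rmin_r]. }
  destruct Hd01 as [Hd01 HdK].
  assert (Hs : forall x, d <= x <= PI / 2 -> 0 < sin x)
    by (intros x Hx; apply sin_gt_0; lra).
  destruct (riemann_lebesgue_C1 (fun u => f u / (2 * sin u))
     (fun u => (f' u * sin u - f u * cos u) / (2 * (sin u * sin u))) d (PI / 2))
    as [B HB]; [lra| | |].
  { intros x Hx. specialize (Hs x Hx). auto_derive.
    - repeat split; [now exists (f' x)|lra].
    - replace (Derive (fun x => f x) x) with (f' x) by (symmetry; apply is_derive_unique; now apply Hd). field. lra. }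
  { intros x Hx. specialize (Hs x Hx).
    apply (continuous_mult (fun u => f' u * sin u - f u * cos u)
             (fun u => / (2 * (sin u * sin u)))).
    - apply (continuous_minus (fun u => f' u * sin u) (fun u => f u * cos u)).
      + apply (continuous_mult f' sin); [apply Hc|].
        apply (ex_derive_continuous sin). now auto_derive.
      + apply (ex_derive_continuous (fun u => f u * cos u)).
        auto_derive. now exists (f' x).
    - apply (ex_derive_continuous (fun u => / (2 * (sin u * sin u)))).
      auto_derive. nra. }
  destruct (nfloor_ex (Rabs B / e)) as [N HN].
  { apply Rdiv_le_0_compat; [apply Rabs_pos|easy]. }
  exists N. intros M HM. rewrite Rminus_0_r.
  specialize (Hsum M).
  set (S := sum_n _ M) in *. clearbody S.
  assert (Hex : ex_RInt (fun u => f u * D M u) 0 d).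
  { apply (ex_RInt_Chasles_1 (V := R_CompleteNormedModule)) with (PI / 2); [lra|now exists S]. }
  assert (Hex' : ex_RInt (fun u => f u * D M u) d (PI / 2)).
  { apply (ex_RInt_Chasles_2 (V := R_CompleteNormedModule)) with 0; [lra|now exists S]. }
  destruct Hex as [I1 HI1]. destruct Hex' as [I2 HI2].
  assert (HS : S = I1 + I2).
  { rewrite <- (is_RInt_unique _ _ _ _ Hsum). apply is_RInt_unique.
    now apply (is_RInt_Chasles (V := R_NormedModule) _ 0 d (PI / 2)). }
  assert (H1 : Rabs I1 <= e / 2).
  { apply Rle_trans with (2 := HdK). rewrite <- (Rminus_0_r d) at 1.
    refine (norm_RInt_le_const _ _ _ _ K _ _ HI1); [lra|].
    intros x Hx. apply Hnear. lra. }
  assert (HMN : INR N <= INR M) by now apply le_INR.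
  pose proof (pos_INR N) as HN0.
  assert (H2 : Rabs I2 <= B / (2 * (INR M + 1))).
  { apply HB; [lra|].
    apply (is_RInt_ext (fun u => f u * D M u)); [|easy].
    rewrite Rmin_left, Rmax_right by lra. intros x Hx.
    change (f x * D M x = f x / (2 * sin x) * sin (2 * (INR M + 1) * x)).
    rewrite <- two_sin_mult_sum_cos_odd. fold (D M x).
    assert (0 < sin x) by (apply Hs; lra). field. lra. }
  assert (H3 : B / (2 * (INR M + 1)) < e / 2).
  { apply (Rmult_lt_reg_r (2 * (INR M + 1))); [lra|].
    replace (B / (2 * (INR M + 1)) * (2 * (INR M + 1))) with B by (field; lra).
    apply Rle_lt_trans with (1 := Rle_abs B).
    apply Rlt_le_trans with (e * (INR N + 1)); [|nra].
    rewrite (Rmult_comm e). apply Rlt_div_l; [lra|]. apply HN. }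
  rewrite HS. pose proof (Rabs_triang I1 I2). lra.
Qed.

Lemma is_RInt_cos_odd (n : nat) :
  is_RInt (fun u => cos ((2 * INR n + 1) * u)) 0 (PI / 2) ((-1) ^ n / INR (2 * n + 1)).
Proof.
  pose proof (pos_INR n).
  replace ((-1) ^ n / INR (2 * n + 1)) with
   (minus (sin ((2 * INR n + 1) * (PI / 2)) / (2 * INR n + 1))
     (sin ((2 * INR n + 1) * 0) / (2 * INR n + 1))).
  - apply (is_RInt_derive (fun u => sin ((2 * INR n + 1) * u) / (2 * INR n + 1))).
    + intros x _. auto_derive; [easy|]. field. lra.
    + intros x _. apply (ex_derive_continuous (fun u => cos ((2 * INR n + 1) * u))).
      now auto_derive.
  - rewrite Rmult_0_r, sin_0. unfold minus, plus, opp; simpl.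
    replace ((2 * INR n + 1) * (PI / 2)) with (INR n * PI + PI / 2) by field.
    rewrite sin_plus, cos_PI2, sin_PI2.
    assert (Hc : forall n, cos (INR n * PI) = (-1) ^ n).
    { clear. induction n as [|n IH].
      - simpl. rewrite Rmult_0_l. apply cos_0.
      - rewrite S_INR, Rmult_plus_distr_r, Rmult_1_l, neg_cos, IH. simpl. ring. }
    rewrite Hc. change (n + (n + 0))%nat with (2 * n)%nat.
    rewrite plus_INR, mult_INR. simpl. field. lra.
Qed.

Lemma leibniz_series :
  is_series (fun n => (-1) ^ n / INR (2 * n + 1)) (PI / 4).
Proof.
  rewrite <- Alt_PI_eq. unfold Alt_PI. destruct exist_PI as [l Hl].
  replace (4 * l / 4) with l by field.
  apply is_lim_seq_Reals in Hl. revert Hl. apply is_lim_seq_ext.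
  intro n. now rewrite sum_n_Reals.
Qed.

(** Dirichlet's theorem at the point [0], by splitting
    [f = (f - f 0) + f 0]. *)
Lemma cos_odd_series (f f' : R -> R) :
  (forall x, is_derive f x (f' x)) -> (forall x, continuous f' x) ->
  is_series (fun n => RInt (fun u => f u * cos ((2 * INR n + 1) * u)) 0 (PI / 2))
    (PI / 4 * f 0).
Proof.
  intros Hd Hc.
  assert (Hz : is_series (fun n =>
      RInt (fun u => (f u - f 0) * cos ((2 * INR n + 1) * u)) 0 (PI / 2)) 0).
  { apply (cos_odd_series_vanishing (fun u => f u - f 0) f'); [|easy|ring].
    intro x. auto_derive; [now exists (f' x)|].
    replace (Derive (fun x => f x) x) with (f' x) by (symmetry; apply is_derive_unique; now apply Hd). ring. }
  pose proof (is_series_plus _ _ _ _ Hz (is_series_scal (f 0) _ _ leibniz_series)) as H.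
  replace (PI / 4 * f 0) with (plus 0 (scal (f 0) (PI / 4)))
    by (unfold plus, scal; simpl; unfold mult; simpl; ring).
  revert H. apply is_series_ext. intro n.
  symmetry. apply is_RInt_unique.
  apply (is_RInt_ext (fun u => plus ((f u - f 0) * cos ((2 * INR n + 1) * u))
     (scal (f 0) (cos ((2 * INR n + 1) * u))))).
  { intros x _. unfold plus, scal; simpl; unfold mult; simpl. ring. }
  apply (is_RInt_plus (V := R_NormedModule)).
  - apply (RInt_correct (V := R_CompleteNormedModule)), (ex_RInt_continuous (V := R_CompleteNormedModule)).
    intros x _. apply (ex_derive_continuous (fun u => (f u - f 0) * cos ((2 * INR n + 1) * u))).
    auto_derive. now exists (f' x).
  - apply (is_RInt_scal (V := R_NormedModule)), is_RInt_cos_odd.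
Qed.

(** * The Taylor remainder of the cosine at its zeros *)

Lemma sum_n_Rmult_l (c : R) (a : nat -> R) (m : nat) :
  sum_n (fun k => c * a k) m = c * sum_n a m.
Proof. exact (sum_n_mult_l (K := R_Ring) c a m). Qed.

(** Up to the factor [(-1)^m N^(2m+2)], with [N = 2 n + 1], the value of the
    degree [2 m] Taylor polynomial of [cos] at its zero [N PI / 2]. *)
Definition taylor_moment (m n : nat) : R :=
  RInt (fun u => (PI / 2 - u) ^ (2 * m + 1) / INR (fact (2 * m + 1))
                 * cos ((2 * INR n + 1) * u)) 0 (PI / 2).

Lemma is_derive_taylor_monomial (j : nat) (x : R) :
  is_derive (fun u => (PI / 2 - u) ^ S j / INR (fact (S j))) x
    (- ((PI / 2 - x) ^ j / INR (fact j))).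
Proof.
  auto_derive; [easy|].
  change (fact j + j * fact j)%nat with (S j * fact j)%nat. rewrite mult_INR.
  pose proof (INR_fact_neq_0 j). pose proof (not_0_INR (S j) ltac:(lia)).
  change (match j with O => 1 | S _ => INR j + 1 end) with (INR (S j)).
  unfold Rminus. field. auto.
Qed.

Lemma ex_RInt_taylor_moment (m n : nat) :
  ex_RInt (fun u => (PI / 2 - u) ^ (2 * m + 1) / INR (fact (2 * m + 1))
                 * cos ((2 * INR n + 1) * u)) 0 (PI / 2).
Proof.
  apply (ex_RInt_continuous (V := R_CompleteNormedModule)). intros x _.
  apply (ex_derive_continuous (fun u => (PI / 2 - u) ^ (2 * m + 1)
     / INR (fact (2 * m + 1)) * cos ((2 * INR n + 1) * u))).
  now auto_derive.
Qed.

Lemma taylor_moment_0 (n : nat) : taylor_moment 0 n = / (2 * INR n + 1) ^ 2.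
Proof.
  pose proof (pos_INR n).
  apply (is_RInt_unique (V := R_CompleteNormedModule)).
  replace (/ (2 * INR n + 1) ^ 2) with
   (minus ((PI / 2 - PI / 2) * sin ((2 * INR n + 1) * (PI / 2)) / (2 * INR n + 1)
            - cos ((2 * INR n + 1) * (PI / 2)) / (2 * INR n + 1) ^ 2)
     ((PI / 2 - 0) * sin ((2 * INR n + 1) * 0) / (2 * INR n + 1)
            - cos ((2 * INR n + 1) * 0) / (2 * INR n + 1) ^ 2)).
  - apply (is_RInt_derive (fun u => (PI / 2 - u) * sin ((2 * INR n + 1) * u) / (2 * INR n + 1)
            - cos ((2 * INR n + 1) * u) / (2 * INR n + 1) ^ 2)).
    + intros x _. auto_derive; [easy|]. simpl. field. lra.
    + intros x _. apply (ex_derive_continuous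
        (fun u => (PI / 2 - u) ^ (2 * 0 + 1) / INR (fact (2 * 0 + 1))
                 * cos ((2 * INR n + 1) * u))).
      now auto_derive.
  - rewrite Rmult_0_r, sin_0, cos_0. unfold minus, plus, opp; simpl.
    replace ((2 * INR n + 1) * (PI / 2)) with (PI / 2 + INR n * PI) by field.
    rewrite cos_plus, cos_PI2, sin_PI2.
    rewrite (sin_eq_0_1 (INR n * PI)) by (exists (Z.of_nat n); now rewrite <- INR_IZR_INZ).
    field. lra.
Qed.

(** Two integrations by parts at once: with [p j u = (PI/2 - u)^j / j!], so that
    [p (j+1)' = - p j], the function
    [N p (2m+3) sin (N u) - p (2m+2) cos (N u)] is an antiderivative of
    [N^2 p (2m+3) cos (N u) + p (2m+1) cos (N u)], and its only nonzero boundary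
    term is the cosine one at [0]. *)
Lemma taylor_moment_S (m n : nat) :
  (2 * INR n + 1) ^ 2 * taylor_moment (S m) n
  = (PI / 2) ^ (2 * m + 2) / INR (fact (2 * m + 2)) - taylor_moment m n.
Proof.
  pose proof (pos_INR n) as Hn.
  set (N := 2 * INR n + 1) in *.
  set (p := fun j u => (PI / 2 - u) ^ j / INR (fact j)).
  assert (HN : 0 < N) by (unfold N; lra).
  assert (Hp : forall j x, is_derive (p (S j)) x (- p j x))
    by exact is_derive_taylor_monomial.
  assert (HG : is_RInt
     (fun u => N ^ 2 * (p (2 * m + 3)%nat u * cos (N * u)) + p (2 * m + 1)%nat u * cos (N * u))
     0 (PI / 2) (p (2 * m + 2)%nat 0)).
  { replace (p (2 * m + 2)%nat 0) with
     (minus (N * (p (2 * m + 3)%nat (PI / 2) * sin (N * (PI / 2)))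
               - p (2 * m + 2)%nat (PI / 2) * cos (N * (PI / 2)))
        (N * (p (2 * m + 3)%nat 0 * sin (N * 0)) - p (2 * m + 2)%nat 0 * cos (N * 0))).
    - apply (is_RInt_derive (fun u => N * (p (2 * m + 3)%nat u * sin (N * u))
               - p (2 * m + 2)%nat u * cos (N * u))); intros x _.
      + pose proof (Hp (2 * m + 2)%nat x) as H3.
        pose proof (Hp (2 * m + 1)%nat x) as H2.
        replace (S (2 * m + 2)) with (2 * m + 3)%nat in H3 by lia.
        replace (S (2 * m + 1)) with (2 * m + 2)%nat in H2 by lia.
        auto_derive.
        * split; [eexists; apply H3|split; [eexists; apply H2|easy]].
        * change (m + (m + 0))%nat with (2 * m)%nat.
          replace (Derive (fun x => p (2 * m + 3)%nat x) x) with (- p (2 * m + 2)%nat x)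
            by (symmetry; apply is_derive_unique, H3).
          replace (Derive (fun x => p (2 * m + 2)%nat x) x) with (- p (2 * m + 1)%nat x)
            by (symmetry; apply is_derive_unique, H2).
          ring.
      + apply (ex_derive_continuous (fun u => N ^ 2 * (p (2 * m + 3)%nat u * cos (N * u))
           + p (2 * m + 1)%nat u * cos (N * u))).
        unfold p. now auto_derive.
    - rewrite Rmult_0_r, sin_0, cos_0. unfold minus, plus, opp; cbn -[Nat.mul Nat.add].
      assert (H0 : forall j, (0 < j)%nat -> p j (PI / 2) = 0).
      { intros j Hj. unfold p. rewrite Rminus_diag, pow_i by easy. apply Rdiv_0_l. }
      rewrite !H0 by lia. ring. }
  apply (is_RInt_unique (V := R_CompleteNormedModule)) in HG.
  rewrite <- (Rminus_0_r (PI / 2)) at 1.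
  change ((PI / 2 - 0) ^ (2 * m + 2) / INR (fact (2 * m + 2))) with (p (2 * m + 2)%nat 0).
  rewrite <- HG.
  pose proof (RInt_correct (V := R_CompleteNormedModule) _ _ _ (ex_RInt_taylor_moment m n)) as H1.
  pose proof (RInt_correct (V := R_CompleteNormedModule) _ _ _ (ex_RInt_taylor_moment (S m) n)) as H2.
  fold (taylor_moment m n) in H1. fold (taylor_moment (S m) n) in H2.
  replace (2 * S m + 1)%nat with (2 * m + 3)%nat in H2 by lia.
  pose proof (is_RInt_plus _ _ _ _ _ _ (is_RInt_scal _ _ _ (N ^ 2) _ H2) H1) as H.
  apply (is_RInt_unique (V := R_CompleteNormedModule)) in H.
  transitivity (N ^ 2 * taylor_moment (S m) n + taylor_moment m n - taylor_moment m n); [ring|].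
  f_equal. symmetry. exact H.
Qed.

(** That [N PI / 2] is a zero of [cos] enters through [taylor_moment_0], the
    base of the induction. *)
Lemma taylor_moment_sum (m n : nat) :
  sum_n (fun k => (-1) ^ k * ((PI / 2) ^ (2 * k) / INR (fact (2 * k)))
                  * / (2 * INR n + 1) ^ (2 * (m - k) + 2)) m
  = (-1) ^ m * taylor_moment m n.
Proof.
  pose proof (pos_INR n) as Hn.
  induction m as [|m IH].
  - rewrite sum_O, taylor_moment_0. simpl. field. lra.
  - rewrite sum_Sn, Nat.sub_diag.
    rewrite (sum_n_ext_loc _ (fun k => / (2 * INR n + 1) ^ 2 *
      ((-1) ^ k * ((PI / 2) ^ (2 * k) / INR (fact (2 * k)))
                  * / (2 * INR n + 1) ^ (2 * (m - k) + 2)))).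
    + rewrite sum_n_Rmult_l, IH. change plus with Rplus.
      apply (Rmult_eq_reg_l ((2 * INR n + 1) ^ 2)); [|apply pow_nonzero; lra].
      pose proof (taylor_moment_S m n) as HS.
      replace (2 * S m)%nat with (2 * m + 2)%nat by lia.
      transitivity ((-1) ^ S m *
        ((PI / 2) ^ (2 * m + 2) / INR (fact (2 * m + 2)) - taylor_moment m n)).
      * pose proof (INR_fact_neq_0 (2 * m + 2)). simpl. field. split; [easy|lra].
      * rewrite <- HS. ring.
    + intros k Hk.
      replace (2 * (S m - k) + 2)%nat with (2 + (2 * (m - k) + 2))%nat by lia.
      rewrite pow_add, Rinv_mult. refine (_ : _ = _ :> R). ring.
Qed.

(** * The recurrence for the sums of inverse powers of odd integers *)

Lemma taylor_moment_series (m : nat) :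
  is_series (taylor_moment m)
    (PI / 4 * ((PI / 2) ^ (2 * m + 1) / INR (fact (2 * m + 1)))).
Proof.
  unfold taylor_moment.
  replace (2 * m + 1)%nat with (S (2 * m)) by lia.
  replace ((PI / 2) ^ S (2 * m)) with ((PI / 2 - 0) ^ S (2 * m))
    by now rewrite Rminus_0_r.
  apply (cos_odd_series (fun u => (PI / 2 - u) ^ S (2 * m) / INR (fact (S (2 * m))))
    (fun u => - ((PI / 2 - u) ^ (2 * m) / INR (fact (2 * m))))).
  - intro x. apply is_derive_taylor_monomial.
  - intro x. apply (ex_derive_continuous
      (fun u => - ((PI / 2 - u) ^ (2 * m) / INR (fact (2 * m))))).
    now auto_derive.
Qed.

(** The exponent-[2] series dominates the others, and it converges because its
    terms are the [taylor_moment 0 n]. *)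
Lemma ex_series_odd_pow (j : nat) :
  ex_series (fun n => / (2 * INR n + 1) ^ (j + 2)).
Proof.
  apply (ex_series_le (V := R_CompleteNormedModule) _ (taylor_moment 0)).
  - intro n. rewrite taylor_moment_0.
    pose proof (pos_INR n). change norm with Rabs.
    assert (H1 : forall i, 0 < (2 * INR n + 1) ^ i) by (intro i; apply pow_lt; lra).
    rewrite Rabs_pos_eq by (left; apply Rinv_0_lt_compat, H1).
    apply Rinv_le_contravar; [apply H1|]. apply Rle_pow; [lra|lia].
  - eexists. apply taylor_moment_series.
Qed.

Lemma is_series_sum_n (a : nat -> nat -> R) (l : nat -> R) (m : nat) :
  (forall k, is_series (a k) (l k)) ->
  is_series (fun n => sum_n (fun k => a k n) m) (sum_n l m).
Proof.
  intro H. induction m as [|m IH].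
  - rewrite sum_O. apply (is_series_ext (a O)); [|easy].
    intro n. now rewrite sum_O.
  - rewrite sum_Sn.
    apply (is_series_ext (fun n => plus (sum_n (fun k => a k n) m) (a (S m) n))).
    + intro n. now rewrite sum_Sn.
    + exact (is_series_plus _ _ _ _ IH (H (S m))).
Qed.

(** The theorem in real form, divided by [2 ^ (2 m + 1)]. *)
Lemma odd_power_sums_recurrence (m : nat) :
  sum_n (fun k => (-1) ^ k * ((PI / 2) ^ (2 * k) / INR (fact (2 * k)))
                  * Series (fun n => / (2 * INR n + 1) ^ (2 * (m - k) + 2))) m
  = (-1) ^ m * (PI / 4 * ((PI / 2) ^ (2 * m + 1) / INR (fact (2 * m + 1)))).
Proof.
  pose proof (is_series_scal ((-1) ^ m) _ _ (taylor_moment_series m)) as H1.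
  apply is_series_unique in H1. refine (eq_trans _ H1). symmetry.
  apply is_series_unique.
  apply (is_series_ext (fun n => sum_n (fun k =>
     (-1) ^ k * ((PI / 2) ^ (2 * k) / INR (fact (2 * k)))
                  * / (2 * INR n + 1) ^ (2 * (m - k) + 2)) m)).
  - intro n. apply taylor_moment_sum.
  - apply is_series_sum_n. intro k.
    apply (is_series_scal (V := R_NormedModule)). apply Series_correct, ex_series_odd_pow.
Qed.

(** * Passing to complex numbers *)

Lemma RCpow_INR (x : R) (j : nat) : 0 < x -> RCpow x (RtoC (INR j)) = RtoC (x ^ j).
Proof.
  intro Hx. unfold RCpow, Cexp. rewrite <- RtoC_mult. simpl Re; simpl Im.
  rewrite cos_0, sin_0, Rmult_0_r, Rmult_1_r.
  unfold RtoC. f_equal. rewrite <- ln_pow by easy.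
  apply exp_ln. now apply pow_lt.
Qed.

Lemma dirichlet_lambda_INR (j : nat) :
  dirichlet_lambda (RtoC (INR j)) = RtoC (Series (fun n => / (2 * INR n + 1) ^ j)).
Proof.
  assert (Ht : forall n, lambda_term (RtoC (INR j)) n = RtoC (/ (2 * INR n + 1) ^ j)).
  { intro n. pose proof (pos_INR n). unfold lambda_term.
    assert (0 < (2 * INR n + 1) ^ j) by (apply pow_lt; lra).
    rewrite RCpow_INR, <- RtoC_div by lra. f_equal. field. lra. }
  unfold dirichlet_lambda, RtoC. f_equal.
  - apply Series_ext. intro n. now rewrite Ht.
  (* Writing the zero terms as [0 * 0] lets the total [Series] be pulled out
     by linearity. *)
  - rewrite (Series_ext _ (fun n => 0 * 0)) by (intro n; rewrite Ht; simpl; ring).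
    rewrite Series_scal_l. ring.
Qed.

Lemma sum_n_RtoC (a : nat -> R) (m : nat) :
  sum_n (fun k => RtoC (a k)) m = RtoC (sum_n a m).
Proof.
  induction m as [|m IH].
  - now rewrite !sum_O.
  - rewrite !sum_Sn, IH. symmetry. apply RtoC_plus.
Qed.

Theorem corollary1p5 : forall m : nat,
  ((- (1)) ^ (m + 1) * (RtoC PI ^ (2 * m + 2) / (4 * RtoC (INR (fact (2 * m + 1)))))
   + sum_n (fun k : nat =>
       (- (1)) ^ k
       * (2 ^ (2 * m - 2 * k + 1) * RtoC PI ^ (2 * k) / RtoC (INR (fact (2 * k))))
       * dirichlet_lambda (RtoC (INR (2 * m - 2 * k + 2)))) m
   = 0 :> C)%C.
Proof.
  intro m.
  pose proof (INR_fact_neq_0 (2 * m + 1)) as Hf.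
  rewrite (sum_n_ext_loc _ (fun k => RtoC (2 ^ (2 * m + 1) *
    ((-1) ^ k * ((PI / 2) ^ (2 * k) / INR (fact (2 * k)))
       * Series (fun n => / (2 * INR n + 1) ^ (2 * (m - k) + 2)))))).
  - rewrite sum_n_RtoC, sum_n_Rmult_l, odd_power_sums_recurrence.
    rewrite <- RtoC_opp, <- !RtoC_mult, <- !RtoC_pow, <- RtoC_div, <- RtoC_mult, <- RtoC_plus
      by nra.
    apply f_equal.
    replace (2 * m + 2)%nat with (S (2 * m + 1)) by lia.
    replace (- (1)) with (-1) by ring.
    generalize dependent (2 * m + 1)%nat. intros j Hf.
    unfold Rdiv. rewrite Rpow_mult_distr, pow_inv, pow_add. simpl.
    pose proof (pow_nonzero 2 j ltac:(lra)). field. now split.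
  - intros k Hk. pose proof (INR_fact_neq_0 (2 * k)).
    rewrite dirichlet_lambda_INR.
    rewrite <- RtoC_opp, <- !RtoC_pow, <- !RtoC_mult, <- RtoC_div, <- !RtoC_mult by easy.
    apply f_equal.
    replace (2 * (m - k))%nat with (2 * m - 2 * k)%nat by lia.
    replace (2 * m + 1)%nat with (2 * m - 2 * k + 1 + 2 * k)%nat by lia.
    replace (- (1)) with (-1) by ring.
    rewrite (pow_add _ (2 * m - 2 * k + 1)).
    generalize (2 ^ (2 * m - 2 * k + 1)).
    unfold Rdiv. rewrite Rpow_mult_distr, pow_inv. intro c.
    pose proof (pow_nonzero 2 (2 * k) ltac:(lra)). field. now split.
Qed.
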